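(* Let $w\colon A\to B$ be a horizontal arrow in a weakly globular double category $\mathbb{X}$. Then $w\colon\bar A\to\bar B$ is a quasi unit in the fundamental bicategory $\mathbf{Bic}\,\mathbb{X}$ if and only if $w\colon A\to B$ has a vertical companion $w_*\colon A\to B$ in $\mathbb{X}$.
   Context: A double category $\mathbb{X}$ is an internal category in $\mathbf{Cat}$: $\mathbb{X}_0$ is the category of objects and vertical arrows, $\mathbb{X}_1$ the category of horizontal arrows and double cells (with vertical composition $\cdot$, where $\beta\cdot\alpha$ has $\alpha$ on top); horizontal composition is $\circ$. $\mathrm{Id}_A$, $1_A$ are the horizontal and vertical identity arrows, $\mathrm{id}_v$ the horizontal identity cell on a vertical arrow $v$, $1_f$ the vertical identity cell on a horizontal arrow $f$. $\mathbb{X}$ is *weakly globular* if (i) there is an equivalence of categories $\gamma\colon\mathbb{X}_0\to\mathbb{X}_0^d$, where $\mathbb{X}_0^d$ is the discrete category of connected components of $\mathbb{X}_0$, and (ii) for all $n\ge2$ the induced functor from the $n$-fold $\mathbb{X}_1\times_{\mathbb{X}_0}\cdots\times_{\mathbb{X}_0}\mathbb{X}_1$ to the $n$-fold $\mathbb{X}_1\times_{\mathbb{X}_0^d}\cdots\times_{\mathbb{X}_0^d}\mathbb{X}_1$ is an equivalence. In particular $\mathbb{X}_0$ is a posetal groupoid. Horizontal $f\colon A\to B$ and vertical $v\colon A\to B$ are *companions* if there are cells $\psi$ (top $\mathrm{Id}_A$, bottom $f$, left $1_A$, right $v$) and $\chi$ (top $f$, bottom $\mathrm{Id}_B$, left $v$,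 right $1_B$) with $\chi\circ\psi=1_f$ and $\chi\cdot\psi=\mathrm{id}_v$. The *fundamental bicategory* $\mathbf{Bic}\,\mathbb{X}$: objects are the connected components $\bar A$ of $\mathbb{X}_0$ ($\bar A$ the component of $A$); arrows $\bar A\to\bar B$ are the horizontal arrows $A'\to B'$ of $\mathbb{X}$ with $\bar A'=\bar A$, $\bar B'=\bar B$ (no identifications); 2-cells $f\Rightarrow g$ are double cells of $\mathbb{X}$ with top $f$ and bottom $g$ (vertical sides being the unique ones), with vertical composition as in $\mathbb{X}$. For $f\colon A_1\to B_1$, $g\colon B_2\to C_2$ with $\bar B_1=\bar B_2$, a chosen pseudo-inverse of the equivalence (ii) for $n=2$ gives horizontally composable $f_3\colon A_3\to B_3$, $g_3\colon B_3\to C_3$ and vertically invertible cells $f_3\to f$, $g_3\to g$; the composite of $f$ and $g$ is $g_3\circ f_3$, and horizontal composition of 2-cells is obtained by conjugating with these cells. The identity on $\bar A$ is $\mathrm{Id}_{\mu_0(\bar A)}$ with $\mu_0$ a chosen pseudo-inverse of $\gamma$; associativity and unit isomorphisms are the induced ones. An endomorphism $f\colon X\to X$ in a bicategory is a *quasi unit* if there is an invertible 2-cell $f\cong1_X$. (In particular, $w$ being a quasi unit includes $\bar A=\bar B$.) *)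

(* Defs.v *)
From mathcomp Require Import all_boot.
From Stdlib Require Import Relation_Operators Eqdep.
From Stdlib Require Import ProofIrrelevance FunctionalExtensionality
  PropExtensionality IndefiniteDescription.

Set Implicit Arguments.
Unset Strict Implicit.
Unset Printing Implicit Defensive.

Record Category := {
  ob :> Type;
  hom : ob -> ob -> Type;
  idm : forall a, hom a a;
  compm : forall a b c, hom b c -> hom a b -> hom a c;
  compmA : forall a b c d (h : hom c d) (g : hom b c) (f : hom a b),
    compm h (compm g f) = compm (compm h g) f;
  comp1m : forall a b (f : hom a b), compm (idm b) f = f;
  compm1 : forall a b (f : hom a b), compm f (idm a) = f }.

Notation "g \c f" := (compm g f) (at level 40, left associativity).

Record Functor (C D : Category) := {
  fob :> C -> D;
  fmap : forall a b, hom a b -> hom (fob a) (fob b);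
  fmap1 : forall a, fmap (idm a) = idm (fob a);
  fmapM : forall a b c (g : hom b c) (f : hom a b),
    fmap (g \c f) = fmap g \c fmap f }.

Record Iso (C : Category) (a b : C) := {
  fwd :> hom a b;
  bwd : hom b a;
  bwdK : bwd \c fwd = idm a;
  fwdK : fwd \c bwd = idm b }.

Definition idF (C : Category) : Functor C C.
Proof. by exists (fun a => a) (fun _ _ f => f). Defined.

Definition compF (C D E : Category) (G : Functor D E) (F : Functor C D) :
  Functor C E.
Proof.
exists (fun a => G (F a)) (fun _ _ f => fmap G (fmap F f)).
- by move=> a; rewrite !fmap1.
- by move=> a b c g f; rewrite !fmapM.
Defined.

Record NatIso (C D : Category) (F G : Functor C D) := {
  nat_iso :> forall a, Iso (F a) (G a);
  nat_isoP : forall a b (f : hom a b),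
    nat_iso b \c fmap F f = fmap G f \c nat_iso a }.

Record PseudoInverse (C D : Category) (F : Functor C D) := {
  pinv :> Functor D C;
  pinv_unit : NatIso (idF C) (compF pinv F);
  pinv_counit : NatIso (compF F pinv) (idF D) }.

Definition is_equivalence (C D : Category) (F : Functor C D) : Prop :=
  inhabited (PseudoInverse F).

Definition discrete (T : Type) : Category.
Proof.
exists T (fun x y => x = y) (fun=> erefl) (fun x y z q p => etrans p q);
  by move=> * /=; apply: (proof_irrelevance (_ = _)).
Defined.

Definition connected (C : Category) : C -> C -> Prop :=
  clos_refl_sym_trans C (fun a b => inhabited (hom a b)).

(* A component is represented by the set of its objects. *)
Definition pi0 (C : Category) : Type :=
  {P : C -> Prop | exists a, P = connected a}.

Definition component (C : Category) (a : C) : pi0 C :=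
  exist _ (connected a) (ex_intro _ a erefl).

Lemma component_hom (C : Category) (a b : C) (f : hom a b) :
  component a = component b.
Proof.
have E : connected a = connected b.
  apply: functional_extensionality => c; apply: propositional_extensionality.
  split=> H; apply: rst_trans H; last by apply: rst_step.
  by apply: rst_sym; apply: rst_step.
rewrite /component; move: (ex_intro _ a _) (ex_intro _ b _); rewrite E => p q.
by rewrite (proof_irrelevance _ p q).
Qed.

Definition gamma (C : Category) : Functor C (discrete (pi0 C)).
Proof.
exists (@component C : C -> discrete (pi0 C)) (fun a b f => component_hom f);
  by move=> * /=; apply: (proof_irrelevance (_ = _)).
Defined.

Definition cast_hom (C : Category) (a a' b b' : C) (p : a = a') (q : b = b')
    (f : hom a b) : hom a' b' :=
  match p, q with erefl, erefl => f end.

Record fibob (C D : Category) (s t : Functor D C) (n : nat) := {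
  fibv :> 'I_n -> D;
  fib_match : forall i j : 'I_n, j = i.+1 :> nat -> t (fibv i) = s (fibv j) }.

Record fibhom (C D : Category) (s t : Functor D C) (n : nat)
    (x y : fibob s t n) := {
  fibm :> forall i, hom (x i) (y i);
  fibm_match : forall (i j : 'I_n) (E : j = i.+1 :> nat),
    cast_hom (fib_match x E) (fib_match y E) (fmap t (fibm i))
      = fmap s (fibm j) }.

Lemma fibhom_eq (C D : Category) (s t : Functor D C) (n : nat)
    (x y : fibob s t n) (f g : fibhom x y) : (forall i, f i = g i) -> f = g.
Proof.
case: f g => [f pf] [g pg] /= H.
have E : f = g by apply: functional_extensionality_dep.
by case: g / E pg {H} => pg; rewrite (proof_irrelevance _ pf pg).
Qed.

Lemma cast_hom1 (C : Category) (a b : C) (p q : a = b) :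
  cast_hom p q (idm a) = idm b.
Proof. by rewrite (proof_irrelevance _ q p); case: b / p q. Qed.

Lemma cast_homM (C : Category) (a a' b b' c c' : C) (p : a = a') (q : b = b')
    (r : c = c') (g : hom b c) (f : hom a b) :
  cast_hom p r (g \c f) = cast_hom q r g \c cast_hom p q f.
Proof. by case: a' / p; case: b' / q; case: c' / r. Qed.

Lemma cast_hom_fmap (C D : Category) (K : Functor C D) (a a' b b' : C)
    (p : a = a') (q : b = b') (p' : K a = K a') (q' : K b = K b')
    (f : hom a b) :
  cast_hom p' q' (fmap K f) = fmap K (cast_hom p q f).
Proof.
case: a' / p p' => p'; case: b' / q q' => q'.
by rewrite (proof_irrelevance _ p' erefl) (proof_irrelevance _ q' erefl).
Qed.

Definition fibre_power (C D : Category) (s t : Functor D C) (n : nat) :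
  Category.
Proof.
unshelve refine (@Build_Category (fibob s t n) (@fibhom C D s t n)
  (fun x => @Build_fibhom _ _ s t n x x (fun i => idm (x i)) _)
  (fun x y z g f =>
     @Build_fibhom _ _ s t n x z (fun i => g i \c f i) _) _ _ _).
- by move=> i j E; rewrite !fmap1 cast_hom1.
- by move=> i j E; rewrite !fmapM (cast_homM _ (fib_match y E)) !fibm_match.
- by move=> *; apply: fibhom_eq => i /=; rewrite compmA.
- by move=> *; apply: fibhom_eq => i /=; rewrite comp1m.
- by move=> *; apply: fibhom_eq => i /=; rewrite compm1.
Defined.

Definition fibob_map (C C' D : Category) (s t : Functor D C)
    (K : Functor C C') (n : nat) (x : fibob s t n) :
    fibob (compF K s) (compF K t) n :=
  @Build_fibob C' D (compF K s) (compF K t) n (fibv x)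
    (fun i j E => congr1 K (fib_match x E)).

Lemma fibhom_map_match (C C' D : Category) (s t : Functor D C)
    (K : Functor C C') (n : nat) (x y : fibob s t n) (f : fibhom x y)
    (i j : 'I_n) (E : j = i.+1 :> nat) :
  cast_hom (fib_match (fibob_map K x) E) (fib_match (fibob_map K y) E)
      (fmap (compF K t) (fibm f i))
    = fmap (compF K s) (fibm f j).
Proof.
by rewrite /= (cast_hom_fmap (fib_match x E) (fib_match y E)) fibm_match.
Qed.

Definition fibre_power_map (C C' D : Category) (s t : Functor D C)
    (K : Functor C C') (n : nat) :
  Functor (fibre_power s t n) (fibre_power (compF K s) (compF K t) n).
Proof.
unshelve refine (@Build_Functor (fibre_power s t n)
  (fibre_power (compF K s) (compF K t) n) (@fibob_map C C' D s t K n)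
  (fun x y f => @Build_fibhom C' D (compF K s) (compF K t) n
     (fibob_map K x) (fibob_map K y) (fibm f)
     (fun i j E => fibhom_map_match K f E)) _ _).
- by move=> x; apply: fibhom_eq.
- by move=> x y z g f; apply: fibhom_eq.
Defined.

(* [bcomp f g] is the composite "f followed by g". *)
Record Bicategory := {
  bob :> Type;
  bhom : bob -> bob -> Category;
  bid : forall a, bhom a a;
  bcomp : forall a b c, bhom a b -> bhom b c -> bhom a c;
  bcomp2 : forall a b c (f f' : bhom a b) (g g' : bhom b c),
    hom f f' -> hom g g' -> hom (bcomp f g) (bcomp f' g');
  bcomp2_id : forall a b c (f : bhom a b) (g : bhom b c),
    bcomp2 (idm f) (idm g) = idm (bcomp f g);
  bcomp2_comp : forall a b c (f f' f'' : bhom a b) (g g' g'' : bhom b c)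
    (al' : hom f' f'') (al : hom f f') (be' : hom g' g'') (be : hom g g'),
    bcomp2 (al' \c al) (be' \c be) = bcomp2 al' be' \c bcomp2 al be;
  bassoc : forall a b c d (f : bhom a b) (g : bhom b c) (h : bhom c d),
    Iso (bcomp (bcomp f g) h) (bcomp f (bcomp g h));
  blunit : forall a b (f : bhom a b), Iso (bcomp (bid a) f) f;
  brunit : forall a b (f : bhom a b), Iso (bcomp f (bid b)) f;
  bassoc_nat : forall a b c d (f f' : bhom a b) (g g' : bhom b c)
    (h h' : bhom c d) (al : hom f f') (be : hom g g') (ga : hom h h'),
    bassoc f' g' h' \c bcomp2 (bcomp2 al be) ga
      = bcomp2 al (bcomp2 be ga) \c bassoc f g h;
  blunit_nat : forall a b (f f' : bhom a b) (al : hom f f'),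
    blunit f' \c bcomp2 (idm (bid a)) al = al \c blunit f;
  brunit_nat : forall a b (f f' : bhom a b) (al : hom f f'),
    brunit f' \c bcomp2 al (idm (bid b)) = al \c brunit f;
  bpentagon : forall a b c d e (f : bhom a b) (g : bhom b c) (h : bhom c d)
    (k : bhom d e),
    bassoc f g (bcomp h k) \c bassoc (bcomp f g) h k
      = bcomp2 (idm f) (bassoc g h k) \c
        (bassoc f (bcomp g h) k \c bcomp2 (bassoc f g h) (idm k));
  btriangle : forall a b c (f : bhom a b) (g : bhom b c),
    bcomp2 (idm f) (blunit g) \c bassoc f (bid b) g
      = bcomp2 (brunit f) (idm g) }.

Definition quasi_unit (B : Bicategory) (a : B) (f : bhom a a) : Prop :=
  inhabited (Iso f (bid a)).

(* Equality of two cells between the same four corners whose horizontal and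
   vertical sides are equal, though not necessarily convertible. *)
Inductive cell_eq (O : Type) (H V : O -> O -> Type)
    (cell : forall A B C D, H A B -> V A C -> V B D -> H C D -> Type)
    (A B C D : O) (f : H A B) (v : V A C) (w : V B D) (g : H C D)
    (al : cell A B C D f v w g) :
  forall f' v' w' g', cell A B C D f' v' w' g' -> Prop :=
| cell_refl : cell_eq al al.

(* An internal category in Cat, in elementary terms. A cell
   [al : cell f v w g] has top f, left side v, right side w and bottom g:

         A --f--> B
         |        |
         v   al   w
         |        |
         C --g--> D

   All composites are written in applicative order, so [cvcomp be al] has al
   on top and [chcomp be al] has al on the left. *)
Record DoubleCategory := {
  dob :> Type;
  ver : dob -> dob -> Type;
  hor : dob -> dob -> Type;
  cell : forall A B C D, hor A B -> ver A C -> ver B D -> hor C D -> Type;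

  vid : forall A, ver A A;
  vcomp : forall A B C, ver B C -> ver A B -> ver A C;
  vcompA : forall A B C D (w : ver C D) (v : ver B C) (u : ver A B),
    vcomp w (vcomp v u) = vcomp (vcomp w v) u;
  vcomp1l : forall A B (v : ver A B), vcomp (vid B) v = v;
  vcomp1r : forall A B (v : ver A B), vcomp v (vid A) = v;

  hid : forall A, hor A A;
  hcomp : forall A B C, hor B C -> hor A B -> hor A C;
  hcompA : forall A B C D (h : hor C D) (g : hor B C) (f : hor A B),
    hcomp h (hcomp g f) = hcomp (hcomp h g) f;
  hcomp1l : forall A B (f : hor A B), hcomp (hid B) f = f;
  hcomp1r : forall A B (f : hor A B), hcomp f (hid A) = f;

  cvid : forall A B (f : hor A B), cell f (vid A) (vid B) f;
  cvcomp : forall A B C D E F (f : hor A B) (g : hor C D) (h : hor E F)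
    (v : ver A C) (w : ver B D) (v' : ver C E) (w' : ver D F),
    cell g v' w' h -> cell f v w g -> cell f (vcomp v' v) (vcomp w' w) h;
  cvcompA : forall A0 B0 A1 B1 A2 B2 A3 B3
    (f0 : hor A0 B0) (f1 : hor A1 B1) (f2 : hor A2 B2) (f3 : hor A3 B3)
    (v1 : ver A0 A1) (w1 : ver B0 B1) (v2 : ver A1 A2) (w2 : ver B1 B2)
    (v3 : ver A2 A3) (w3 : ver B2 B3)
    (ga : cell f2 v3 w3 f3) (be : cell f1 v2 w2 f2) (al : cell f0 v1 w1 f1),
    cell_eq (cvcomp ga (cvcomp be al)) (cvcomp (cvcomp ga be) al);
  cvcomp1l : forall A B C D (f : hor A B) (v : ver A C) (w : ver B D)
    (g : hor C D) (al : cell f v w g), cell_eq (cvcomp (cvid g) al) al;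
  cvcomp1r : forall A B C D (f : hor A B) (v : ver A C) (w : ver B D)
    (g : hor C D) (al : cell f v w g), cell_eq (cvcomp al (cvid f)) al;

  chid : forall A B (v : ver A B), cell (hid A) v v (hid B);
  chcomp : forall A B C A' B' C' (f : hor A B) (g : hor B C)
    (f' : hor A' B') (g' : hor B' C')
    (u : ver A A') (v : ver B B') (w : ver C C'),
    cell g v w g' -> cell f u v f' -> cell (hcomp g f) u w (hcomp g' f');
  chcompA : forall A B C D A' B' C' D'
    (f : hor A B) (g : hor B C) (h : hor C D)
    (f' : hor A' B') (g' : hor B' C') (h' : hor C' D')
    (u : ver A A') (v : ver B B') (w : ver C C') (x : ver D D')
    (ga : cell h w x h') (be : cell g v w g') (al : cell f u v f'),
    cell_eq (chcomp ga (chcomp be al)) (chcomp (chcomp ga be) al);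
  chcomp1l : forall A B C D (f : hor A B) (v : ver A C) (w : ver B D)
    (g : hor C D) (al : cell f v w g), cell_eq (chcomp (chid w) al) al;
  chcomp1r : forall A B C D (f : hor A B) (v : ver A C) (w : ver B D)
    (g : hor C D) (al : cell f v w g), cell_eq (chcomp al (chid v)) al;

  chid_vid : forall A, chid (vid A) = cvid (hid A);
  chid_vcomp : forall A B C (w : ver B C) (v : ver A B),
    chid (vcomp w v) = cvcomp (chid w) (chid v);
  cvid_hcomp : forall A B C (g : hor B C) (f : hor A B),
    cvid (hcomp g f) = chcomp (cvid g) (cvid f);
  interchange : forall A B C A' B' C' A'' B'' C''
    (f : hor A B) (g : hor B C) (f' : hor A' B') (g' : hor B' C')
    (f'' : hor A'' B'') (g'' : hor B'' C'')
    (u : ver A A') (v : ver B B') (w : ver C C')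
    (u' : ver A' A'') (v' : ver B' B'') (w' : ver C' C'')
    (be' : cell g' v' w' g'') (al' : cell f' u' v' f'')
    (be : cell g v w g') (al : cell f u v f'),
    chcomp (cvcomp be' be) (cvcomp al' al)
      = cvcomp (chcomp be' al') (chcomp be al) }.

Definition companions (X : DoubleCategory) (A B : X) (f : hor A B)
    (v : ver A B) : Prop :=
  exists (psi : cell (hid A) (vid A) v f) (chi : cell f v (vid B) (hid B)),
    cell_eq (chcomp chi psi) (cvid f) /\ cell_eq (cvcomp chi psi) (chid v).

Definition has_vertical_companion (X : DoubleCategory) (A B : X)
    (f : hor A B) : Prop :=
  exists v : ver A B, companions f v.

Definition X0 (X : DoubleCategory) : Category :=
  @Build_Category X (@ver X) (@vid X) (@vcomp X)
    (@vcompA X) (@vcomp1l X) (@vcomp1r X).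

Record arrow (X : DoubleCategory) := Arrow {
  hsrc : X; htgt : X; harr :> hor hsrc htgt }.

Record square (X : DoubleCategory) (x y : arrow X) := Square {
  sleft : ver (hsrc x) (hsrc y);
  sright : ver (htgt x) (htgt y);
  scell :> cell x sleft sright y }.

Section CellEq.
Context {X : DoubleCategory}.

Let sq (A B C D : X) (f : hor A B) (v : ver A C) (w : ver B D) (g : hor C D)
    (al : cell f v w g) : {p : arrow X * arrow X & square p.1 p.2} :=
  existT _ (Arrow f, Arrow g) (@Square X (Arrow f) (Arrow g) v w al).

Lemma cell_eq_existT (A B C D : X) (f f' : hor A B) (v v' : ver A C)
    (w w' : ver B D) (g g' : hor C D) (al : cell f v w g)
    (al' : cell f' v' w' g') :
  cell_eq al al' -> sq al = sq al'.
Proof. by case. Qed.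

Lemma square_eq (x y : arrow X) (al be : square x y) :
  cell_eq (scell al) (scell be) -> al = be.
Proof.
case: x y al be => [A B f] [C D g] [v w al] [v' w' be] /= /cell_eq_existT H.
exact: (inj_pair2 _ _ _ _ _ H).
Qed.

End CellEq.

Definition X1 (X : DoubleCategory) : Category.
Proof.
unshelve refine (@Build_Category (arrow X) (@square X)
  (fun x => Square (cvid x))
  (fun x y z be al => Square (cvcomp be al)) _ _ _).
- by move=> *; apply: square_eq; apply: cvcompA.
- by move=> *; apply: square_eq; apply: cvcomp1l.
- by move=> *; apply: square_eq; apply: cvcomp1r.
Defined.

Definition src (X : DoubleCategory) : Functor (X1 X) (X0 X).
Proof. by exists (@hsrc X : X1 X -> X0 X) (@sleft X). Defined.

Definition tgt (X : DoubleCategory) : Functor (X1 X) (X0 X).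
Proof. by exists (@htgt X : X1 X -> X0 X) (@sright X). Defined.

Definition gamma0 (X : DoubleCategory) := gamma (X0 X).

Definition segal (X : DoubleCategory) (n : nat) :
  Functor (fibre_power (src X) (tgt X) n)
    (fibre_power (compF (gamma0 X) (src X)) (compF (gamma0 X) (tgt X)) n) :=
  fibre_power_map (src X) (tgt X) (gamma0 X) n.

Definition weakly_globular (X : DoubleCategory) : Prop :=
  is_equivalence (gamma0 X) /\
  forall n : nat, (2 <= n)%N -> is_equivalence (segal X n).

Definition comp_of (X : DoubleCategory) (A : X) : pi0 (X0 X) :=
  @component (X0 X) A.

Definition idto (C : Category) (a b : C) (p : a = b) : hom a b :=
  match p with erefl => idm a end.

Lemma idto_comp (C : Category) (a b c : C) (q : b = c) (p : a = b) (r : a = c) :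
  idto q \c idto p = idto r.
Proof.
case: c / q r; case: b / p => r.
by rewrite (proof_irrelevance _ r erefl) compm1.
Qed.

Lemma idto_id (C : Category) (a : C) (p : a = a) : idto p = idm a.
Proof. by rewrite (proof_irrelevance _ p erefl). Qed.

Definition idto_iso (C : Category) (a b : C) (p : a = b) : Iso a b.
Proof.
by exists (idto p) (idto (esym p)); rewrite (idto_comp _ _ erefl).
Defined.

Definition inv_iso (C : Category) (a b : C) (f : Iso a b) : Iso b a.
Proof. by exists (bwd f) (fwd f); rewrite ?fwdK ?bwdK. Defined.

Definition comp_iso (C : Category) (a b c : C) (g : Iso b c) (f : Iso a b) :
  Iso a c.
Proof.
exists (fwd g \c fwd f) (bwd f \c bwd g).
- by rewrite compmA -(compmA (bwd f)) bwdK compm1 bwdK.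
- by rewrite compmA -(compmA (fwd g)) fwdK compm1 fwdK.
Defined.

Lemma iso_epi (C : Category) (a b c : C) (f : Iso a b) (g h : hom b c) :
  g \c f = h \c f -> g = h.
Proof.
by move=> H; rewrite -(compm1 g) -(fwdK f) compmA H -compmA fwdK compm1.
Qed.

Lemma gamma0_posetal (X : DoubleCategory) :
  is_equivalence (gamma0 X) -> forall (A B : X) (v w : ver A B), v = w.
Proof.
case=> G A B v w.
have E : fmap (compF G (gamma0 X)) (v : @hom (X0 X) A B)
    = fmap (compF G (gamma0 X)) (w : @hom (X0 X) A B).
  by rewrite /= (proof_irrelevance _ (component_hom _)
    (@component_hom (X0 X) A B w)).
have Hv := nat_isoP (pinv_unit G) (v : @hom (X0 X) A B).
have Hw := nat_isoP (pinv_unit G) (w : @hom (X0 X) A B).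
rewrite E -Hw in Hv.
rewrite -(@comp1m (X0 X) _ _ v) -(@comp1m (X0 X) _ _ w).
rewrite -(bwdK (pinv_unit G B)) -!compmA.
exact: (congr1 (compm (bwd (pinv_unit G B))) Hv).
Qed.

Section Horizontal.
Context {X : DoubleCategory}.
Implicit Types x y z : arrow X.

Lemma square_idto x y x' y' (al : square x y) (al' : square x' y')
    (p : x = x' :> X1 X) (q : y = y' :> X1 X) :
  existT (fun p : arrow X * arrow X => square p.1 p.2) (x, y) al =
    existT (fun p : arrow X * arrow X => square p.1 p.2) (x', y') al' ->
  idto q \c (al : @hom (X1 X) x y) = (al' : @hom (X1 X) x' y') \c idto p.
Proof.
case: x' / p al'; case: y' / q => al' H.
rewrite -(inj_pair2 _ _ _ _ _ H : al = al').
exact: (etrans (@comp1m (X1 X) _ _ al) (esym (@compm1 (X1 X) _ _ al))).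
Qed.

Definition recast_src (A A' B : X) (e : A = A') (g : hor A' B) : hor A B :=
  match esym e in _ = A0 return hor A0 B with erefl => g end.

Definition hco x y (e : htgt x = hsrc y) : arrow X :=
  Arrow (hcomp (recast_src e y) x).

Lemma hcoA x y z (e1 : htgt x = hsrc y) (e2 : htgt y = hsrc z) :
  @hco (hco e1) z e2 = @hco x (hco e2) e1.
Proof.
case: x y z e1 e2 => [A B f] [B' C g] [C' D h] /= e1 e2.
by case: B' / e1 g => g; case: C' / e2 h => h; rewrite /hco /= hcompA.
Qed.

Lemma hco1l x A (e : A = hsrc x) : @hco (Arrow (hid A)) x e = x.
Proof.
by case: x e => [B C f] /= e; case: B / e f => f; rewrite /hco /= hcomp1r.
Qed.

Lemma hco1r x A (e : htgt x = A) : @hco x (Arrow (hid A)) e = x.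
Proof.
by case: x e => [B C f] /= e; case: A / e; rewrite /hco /= hcomp1l.
Qed.

Context (P : forall (A B : X) (v w : ver A B), v = w).

Definition recast_cell (A A' B B' C C' : X) (e : B = A) (e' : B' = A')
    (g : hor A C) (g' : hor A' C') (v : ver A A') (u : ver C C')
    (w : ver B B') :
  cell g v u g' -> cell (recast_src e g) w u (recast_src e' g').
Proof. by case: A / e g v; case: A' / e' g' => g' g v; rewrite (P v w). Defined.

Definition hc x y x' y' (e : htgt x = hsrc y) (e' : htgt x' = hsrc y')
    (al : @hom (X1 X) x x') (be : @hom (X1 X) y y') :
  @hom (X1 X) (hco e) (hco e') :=
  @Square X (hco e) (hco e') (sleft al) (sright be)
    (chcomp (recast_cell e e' (sright al) be) al).

Lemma hcE (A B C A' B' C' : X) (f : hor A B) (g : hor B C)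
    (f' : hor A' B') (g' : hor B' C')
    (u : ver A A') (v : ver B B') (w : ver C C')
    (al : cell f u v f') (be : cell g v w g') :
  @hc (Arrow f) (Arrow g) (Arrow f') (Arrow g') erefl erefl
    (@Square X (Arrow f) (Arrow f') u v al)
    (@Square X (Arrow g) (Arrow g') v w be)
  = @Square X (@hco (Arrow f) (Arrow g) erefl)
      (@hco (Arrow f') (Arrow g') erefl) u w (chcomp be al).
Proof. by rewrite /hc /= (proof_irrelevance _ (P v v) erefl). Qed.

Lemma hc1 x y (e : htgt x = hsrc y) :
  hc e e (@idm (X1 X) x) (@idm (X1 X) y) = @idm (X1 X) (hco e).
Proof.
case: x y e => [A B f] [B' C g] /= e; case: B' / e g => g.
by rewrite hcE /= cvid_hcomp.
Qed.

Lemma hcM x y x' y' x'' y'' (e : htgt x = hsrc y) (e' : htgt x' = hsrc y')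
    (e'' : htgt x'' = hsrc y'')
    (al' : @hom (X1 X) x' x'') (al : @hom (X1 X) x x')
    (be' : @hom (X1 X) y' y'') (be : @hom (X1 X) y y') :
  hc e e'' (al' \c al) (be' \c be) = hc e' e'' al' be' \c hc e e' al be.
Proof.
case: x y x' y' x'' y'' e e' e'' al' al be' be => [A B f] [B0 C g] [A' B' f']
  [B0' C' g'] [A'' B'' f''] [B0'' C'' g''] /= e e' e''.
case: B0 / e g => g; case: B0' / e' g' => g'; case: B0'' / e'' g'' => g''.
case=> u' v' al' [u v al] [v0' w' be'] [v0 w be].
have E : v0 = v by apply: P.
have E' : v0' = v' by apply: P.
subst.
have H := f_equal2 (@compm (X1 X) _ _ _) (hcE al' be') (hcE al be).
apply: etrans (hcE (cvcomp al' al) (cvcomp be' be)) (etrans _ (esym H)).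
by rewrite interchange.
Qed.

Lemma hc_idto x y x' y' (e : htgt x = hsrc y) (e' : htgt x' = hsrc y')
    (p : x = x' :> X1 X) (q : y = y' :> X1 X)
    (r : hco e = hco e' :> X1 X) :
  hc e e' (idto p) (idto q) = idto r.
Proof.
case: x' / p e' r; case: y' / q => e'; rewrite (proof_irrelevance _ e' e) => r.
by rewrite hc1 idto_id.
Qed.

Lemma hc_assoc x y z x' y' z' (e1 : htgt x = hsrc y) (e2 : htgt y = hsrc z)
    (e1' : htgt x' = hsrc y') (e2' : htgt y' = hsrc z')
    (al : @hom (X1 X) x x') (be : @hom (X1 X) y y') (ga : @hom (X1 X) z z') :
  idto (hcoA e1' e2' : _ = _ :> X1 X) \c
    @hc (hco e1) z (hco e1') z' e2 e2' (hc e1 e1' al be) ga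
  = @hc x (hco e2) x' (hco e2') e1 e1' al (hc e2 e2' be ga) \c
    idto (hcoA e1 e2 : _ = _ :> X1 X).
Proof.
apply: square_idto.
case: x y z x' y' z' e1 e2 e1' e2' al be ga
  => [A B f] [B0 C g] [C0 D h] [A' B' f'] [B0' C' g'] [C0' D' h'] /=.
move=> e1 e2 e1' e2'.
case: B0 / e1 g => g; case: C0 / e2 h => h.
case: B0' / e1' g' => g'; case: C0' / e2' h' => h'.
case=> u v al [v0 w be] [w0 t ga].
have E : v0 = v by apply: P.
have E' : w0 = w by apply: P.
subst.
rewrite (hcE al be) (hcE be ga) (hcE (chcomp be al) ga).
rewrite (hcE al (chcomp ga be)).
by have := cell_eq_existT (chcompA ga be al).
Qed.

Lemma hc_lunit x x' (A A' : X) (e : A = hsrc x) (e' : A' = hsrc x')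
    (v : ver A A') (al : @hom (X1 X) x x') :
  idto (hco1l e' : _ = _ :> X1 X) \c
    @hc (Arrow (hid A)) x (Arrow (hid A')) x' e e'
      (@Square X (Arrow (hid A)) (Arrow (hid A')) v v (chid v)) al
  = al \c idto (hco1l e : _ = _ :> X1 X).
Proof.
apply: square_idto.
case: x x' e e' al => [A0 B f] [A0' B' f'] /= e e'.
case: A0 / e f => f; case: A0' / e' f' => f' [v0 w al].
have E : v0 = v by apply: P.
subst; rewrite (hcE (chid v) al).
by have := cell_eq_existT (chcomp1r al).
Qed.

Lemma hc_runit x x' (A A' : X) (e : htgt x = A) (e' : htgt x' = A')
    (v : ver A A') (al : @hom (X1 X) x x') :
  idto (hco1r e' : _ = _ :> X1 X) \c
    @hc x (Arrow (hid A)) x' (Arrow (hid A')) e e'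
      al (@Square X (Arrow (hid A)) (Arrow (hid A')) v v (chid v))
  = al \c idto (hco1r e : _ = _ :> X1 X).
Proof.
apply: square_idto.
case: x x' e e' al => [B A0 f] [B' A0' f'] /= e e'.
case: A / e v; case: A' / e' => v [w v0 al].
have E : v0 = v by apply: P.
subst; rewrite (hcE al (chid v)).
by have := cell_eq_existT (chcomp1l al).
Qed.

Definition hc_iso x y x' y' (e : htgt x = hsrc y) (e' : htgt x' = hsrc y')
    (al : @Iso (X1 X) x x') (be : @Iso (X1 X) y y') :
  @Iso (X1 X) (hco e) (hco e').
Proof.
exists (hc e e' al be) (hc e' e (bwd al) (bwd be)).
- by rewrite -hcM !bwdK hc1.
- by rewrite -hcM !fwdK hc1.
Defined.

End Horizontal.

Lemma comp_iso_invK (C : Category) (a b c d : C) (r : Iso c d) (i : Iso a c)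
    (l : Iso a b) :
  fwd (comp_iso r (comp_iso i (inv_iso l))) \c fwd l = fwd r \c fwd i.
Proof. by rewrite /= -!compmA bwdK compm1. Qed.

Lemma comp_iso_inv2K (C : Category) (a b c : C) (i : Iso a c) (l : Iso a b) :
  fwd (comp_iso i (inv_iso l)) \c fwd l = fwd i.
Proof. by rewrite /= -!compmA bwdK compm1. Qed.

Lemma idto_compE (C : Category) (a b c : C) (q : b = c) (p : a = b) :
  idto q \c idto p = idto (etrans p q).
Proof. exact: idto_comp. Qed.

Section Bic.
Context {X : DoubleCategory} (hX : weakly_globular X)
  (mu0 : PseudoInverse (gamma0 X)) (mu2 : PseudoInverse (segal X 2)).

Let P := gamma0_posetal (proj1 hX).
Notation compX := (@compm (X1 X) _ _ _).
Notation idX x := (@idm (X1 X) x).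

Definition fib_iso (C D : Category) (s t : Functor D C) (n : nat)
  (x y : fibre_power s t n) (f : Iso x y) (i : 'I_n) :
  Iso (fibv x i) (fibv y i).
Proof.
exists (fibm (fwd f) i) (fibm (bwd f) i).
- exact: (congr1 (fun h : fibhom x x => fibm h i) (bwdK f)).
- exact: (congr1 (fun h : fibhom y y => fibm h i) (fwdK f)).
Defined.

(* F 0, ..., F (n-1) as an object of the n-fold fibre product over X_0^d. *)
Definition dstring (n : nat) (F : nat -> arrow X)
    (H : forall k, (k.+1 < n)%N ->
      comp_of (htgt (F k)) = comp_of (hsrc (F k.+1))) :
    fibre_power (compF (gamma0 X) (src X)) (compF (gamma0 X) (tgt X)) n.
Proof.
exists (fun i : 'I_n => F i : X1 X) => i j E.
by rewrite E; apply: H; rewrite -E ltn_ord.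
Defined.

Record barrow (a b : pi0 (X0 X)) := BArrow {
  barr :> arrow X;
  bsrc : comp_of (hsrc barr) = a;
  btgt : comp_of (htgt barr) = b }.

Definition bic_hom (a b : pi0 (X0 X)) : Category :=
  @Build_Category (barrow a b) (fun f g => square f g)
    (fun f => @idm (X1 X) f) (fun f g h => @compm (X1 X) f g h)
    (fun f g h k => @compmA (X1 X) f g h k)
    (fun f g => @comp1m (X1 X) f g) (fun f g => @compm1 (X1 X) f g).

Definition bic_iso (a b : pi0 (X0 X)) (f g : barrow a b)
  (t : @Iso (X1 X) f g) : @Iso (bic_hom a b) f g :=
  @Build_Iso (bic_hom a b) f g (fwd t) (bwd t) (bwdK t) (fwdK t).

Definition bic_id (a : pi0 (X0 X)) : barrow a a :=
  @BArrow a a (Arrow (hid (pinv mu0 a)))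
    (fwd (pinv_counit mu0 a)) (fwd (pinv_counit mu0 a)).

Definition pairF (x y : arrow X) (k : nat) : arrow X :=
  if k is 0 then x else y.

Lemma pairF_match (a b c : pi0 (X0 X)) (f : barrow a b) (g : barrow b c)
  (k : nat) : (k.+1 < 2)%N ->
  comp_of (htgt (pairF f g k)) = comp_of (hsrc (pairF f g k.+1)).
Proof. by case: k => //= _; rewrite btgt bsrc. Qed.

Definition dpair (a b c : pi0 (X0 X)) (f : barrow a b) (g : barrow b c) :=
  @dstring 2 (pairF f g) (pairF_match f g).

Let o0 : 'I_2 := @Ordinal 2 0 isT.
Let o1 : 'I_2 := @Ordinal 2 1 isT.

(* The chosen composable pair for f and g, and its cells to f and to g. *)
Definition bic_fst (a b c : pi0 (X0 X)) (f : barrow a b) (g : barrow b c) :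
  arrow X := fibv (pinv mu2 (dpair f g)) o0.

Definition bic_snd (a b c : pi0 (X0 X)) (f : barrow a b) (g : barrow b c) :
  arrow X := fibv (pinv mu2 (dpair f g)) o1.

Definition bic_match (a b c : pi0 (X0 X)) (f : barrow a b) (g : barrow b c) :
  htgt (bic_fst f g) = hsrc (bic_snd f g) :=
  @fib_match _ _ _ _ _ (pinv mu2 (dpair f g)) o0 o1 erefl.

Definition bic_fst_iso (a b c : pi0 (X0 X)) (f : barrow a b)
  (g : barrow b c) : @Iso (X1 X) (bic_fst f g) f :=
  fib_iso (pinv_counit mu2 (dpair f g)) o0.

Definition bic_snd_iso (a b c : pi0 (X0 X)) (f : barrow a b)
  (g : barrow b c) : @Iso (X1 X) (bic_snd f g) g :=
  fib_iso (pinv_counit mu2 (dpair f g)) o1.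

Definition bic_comp (a b c : pi0 (X0 X)) (f : barrow a b) (g : barrow b c) :
  barrow a c :=
  @BArrow a c (hco (bic_match f g))
    (etrans (@component_hom (X0 X) _ _ (sleft (fwd (bic_fst_iso f g))))
       (bsrc f))
    (etrans (@component_hom (X0 X) _ _ (sright (fwd (bic_snd_iso f g))))
       (btgt g)).

(* The cell into the chosen composite induced by cells from a strictly
   composable pair. *)
Definition bic_into (a b c : pi0 (X0 X)) (f : barrow a b) (g : barrow b c)
  (x y : arrow X) (e : htgt x = hsrc y)
  (phi : @hom (X1 X) x f) (psi : @hom (X1 X) y g) :
  @hom (X1 X) (hco e) (bic_comp f g) :=
  hc P e (bic_match f g)
    (compX (bwd (bic_fst_iso f g)) phi) (compX (bwd (bic_snd_iso f g)) psi).

(* Horizontal composition of 2-cells: conjugation by the chosen cells. *)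
Definition bic_comp2 (a b c : pi0 (X0 X)) (f f' : barrow a b)
  (g g' : barrow b c) (al : @hom (X1 X) f f') (be : @hom (X1 X) g g') :
  @hom (X1 X) (bic_comp f g) (bic_comp f' g') :=
  bic_into (bic_match f g)
    (compX al (fwd (bic_fst_iso f g))) (compX be (fwd (bic_snd_iso f g))).

Section Into.
Variables (a b c : pi0 (X0 X)).
Implicit Types (f : barrow a b) (g : barrow b c).

Lemma bic_into_pre f g x y x' y' (e : htgt x = hsrc y)
    (e' : htgt x' = hsrc y') (phi : @hom (X1 X) x f) (psi : @hom (X1 X) y g)
    (al : @hom (X1 X) x' x) (be : @hom (X1 X) y' y) :
  compX (bic_into e phi psi) (hc P e' e al be)
    = bic_into e' (compX phi al) (compX psi be).
Proof. by rewrite /bic_into -hcM -!compmA. Qed.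

Lemma bic_into_post f f' g g' x y (e : htgt x = hsrc y)
    (phi : @hom (X1 X) x f) (psi : @hom (X1 X) y g)
    (al : @hom (X1 X) f f') (be : @hom (X1 X) g g') :
  compX (bic_comp2 al be) (bic_into e phi psi)
    = bic_into e (compX al phi) (compX be psi).
Proof.
rewrite {2}/bic_into bic_into_pre -!compmA (compmA (fwd (bic_fst_iso _ _))).
by rewrite (compmA (fwd (bic_snd_iso _ _))) !fwdK !comp1m.
Qed.

Lemma bic_comp2_id f g : bic_comp2 (idX f) (idX g) = idX (bic_comp f g).
Proof. by rewrite /bic_comp2 /bic_into !comp1m !bwdK hc1. Qed.

Lemma bic_comp2_comp f f' f'' g g' g''
    (al' : @hom (X1 X) f' f'') (al : @hom (X1 X) f f')
    (be' : @hom (X1 X) g' g'') (be : @hom (X1 X) g g') :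
  bic_comp2 (compX al' al) (compX be' be)
    = compX (bic_comp2 al' be') (bic_comp2 al be).
Proof. by rewrite {3}/bic_comp2 bic_into_post !compmA. Qed.

Definition bic_into_iso f g x y (e : htgt x = hsrc y)
    (phi : @Iso (X1 X) x f) (psi : @Iso (X1 X) y g) :
  @Iso (X1 X) (hco e) (bic_comp f g) :=
  hc_iso P e (bic_match f g)
    (comp_iso (inv_iso (bic_fst_iso f g)) phi)
    (comp_iso (inv_iso (bic_snd_iso f g)) psi).

Lemma bic_into_isoE f g x y (e : htgt x = hsrc y)
    (phi : @Iso (X1 X) x f) (psi : @Iso (X1 X) y g) :
  fwd (bic_into_iso e phi psi) = bic_into e (fwd phi) (fwd psi).
Proof. by []. Qed.

Lemma bic_into_idtoL f g x x' y (e : htgt x = hsrc y) (e' : htgt x' = hsrc y)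
    (p : x = x' :> X1 X) (phi : @hom (X1 X) x' f) (psi : @hom (X1 X) y g) :
  exists r : hco e = hco e' :> X1 X,
    bic_into e (compX phi (idto p)) psi = compX (bic_into e' phi psi) (idto r).
Proof.
case: x' / p e' phi => e' phi.
rewrite (proof_irrelevance _ e' e); exists erefl.
by rewrite !idto_id !compm1.
Qed.

Lemma bic_into_idtoR f g x y y' (e : htgt x = hsrc y) (e' : htgt x = hsrc y')
    (p : y = y' :> X1 X) (phi : @hom (X1 X) x f) (psi : @hom (X1 X) y' g) :
  exists r : hco e = hco e' :> X1 X,
    bic_into e phi (compX psi (idto p)) = compX (bic_into e' phi psi) (idto r).
Proof.
case: y' / p e' psi => e' psi.
rewrite (proof_irrelevance _ e' e); exists erefl.
by rewrite !idto_id !compm1.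
Qed.

End Into.

Definition tripleF (x y z : arrow X) (k : nat) : arrow X :=
  match k with 0 => x | 1 => y | _ => z end.

Definition quadF (x y z w : arrow X) (k : nat) : arrow X :=
  match k with 0 => x | 1 => y | 2 => z | _ => w end.

Record triple (f g h : arrow X) := Triple {
  tr1 : arrow X; tr2 : arrow X; tr3 : arrow X;
  tr12 : htgt tr1 = hsrc tr2; tr23 : htgt tr2 = hsrc tr3;
  tr_iso1 : @Iso (X1 X) tr1 f;
  tr_iso2 : @Iso (X1 X) tr2 g;
  tr_iso3 : @Iso (X1 X) tr3 h }.

Lemma triple_inhabited (a b c d : pi0 (X0 X)) (f : barrow a b)
  (g : barrow b c) (h : barrow c d) : exists t : triple f g h, True.
Proof.
have H k : (k.+1 < 3)%N -> comp_of (htgt (tripleF f g h k))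
    = comp_of (hsrc (tripleF f g h k.+1)).
  by case: k => [|[|k]] //= _; rewrite btgt bsrc.
have [mu] := proj2 hX 3 isT.
pose q := pinv mu (dstring H).
pose i0 := @Ordinal 3 0 isT; pose i1 := @Ordinal 3 1 isT.
pose i2 := @Ordinal 3 2 isT.
have j i := fib_iso (pinv_counit mu (dstring H)) i.
by exists (@Triple f g h (fibv q i0) (fibv q i1) (fibv q i2)
  (@fib_match _ _ _ _ _ q i0 i1 erefl) (@fib_match _ _ _ _ _ q i1 i2 erefl)
  (j i0) (j i1) (j i2)).
Qed.

Lemma quad_exists (a b c d e : pi0 (X0 X)) (f : barrow a b)
  (g : barrow b c) (h : barrow c d) (k : barrow d e) :
  exists (x y z w : arrow X),
    [/\ htgt x = hsrc y, htgt y = hsrc z & htgt z = hsrc w] /\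
    [/\ inhabited (@Iso (X1 X) x f), inhabited (@Iso (X1 X) y g),
        inhabited (@Iso (X1 X) z h) & inhabited (@Iso (X1 X) w k)].
Proof.
have H m : (m.+1 < 4)%N -> comp_of (htgt (quadF f g h k m))
    = comp_of (hsrc (quadF f g h k m.+1)).
  by case: m => [|[|[|m]]] //= _; rewrite btgt bsrc.
have [mu] := proj2 hX 4 isT.
pose q := pinv mu (dstring H).
pose i0 := @Ordinal 4 0 isT; pose i1 := @Ordinal 4 1 isT.
pose i2 := @Ordinal 4 2 isT; pose i3 := @Ordinal 4 3 isT.
have j i := fib_iso (pinv_counit mu (dstring H)) i.
exists (fibv q i0), (fibv q i1), (fibv q i2), (fibv q i3); split; split.
- exact: (@fib_match _ _ _ _ _ q i0 i1 erefl).
- exact: (@fib_match _ _ _ _ _ q i1 i2 erefl).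
- exact: (@fib_match _ _ _ _ _ q i2 i3 erefl).
- by constructor; apply: (j i0).
- by constructor; apply: (j i1).
- by constructor; apply: (j i2).
- by constructor; apply: (j i3).
Qed.

Definition choose_triple (a b c d : pi0 (X0 X)) (f : barrow a b)
  (g : barrow b c) (h : barrow c d) : triple f g h :=
  proj1_sig (constructive_indefinite_description _ (triple_inhabited f g h)).

Section Assoc.
Variables (a b c d : pi0 (X0 X)).
Variables (f : barrow a b) (g : barrow b c) (h : barrow c d).

Definition bic_tripleL (t : triple f g h) :
  @Iso (X1 X) (@hco X (hco (tr12 t)) (tr3 t) (tr23 t))
    (bic_comp (bic_comp f g) h) :=
  @bic_into_iso _ _ _ (bic_comp f g) h (hco (tr12 t)) (tr3 t) (tr23 t)
    (bic_into_iso (tr12 t) (tr_iso1 t) (tr_iso2 t)) (tr_iso3 t).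

Definition bic_tripleR (t : triple f g h) :
  @Iso (X1 X) (@hco X (tr1 t) (hco (tr23 t)) (tr12 t))
    (bic_comp f (bic_comp g h)) :=
  @bic_into_iso _ _ _ f (bic_comp g h) (tr1 t) (hco (tr23 t)) (tr12 t)
    (tr_iso1 t) (bic_into_iso (tr23 t) (tr_iso2 t) (tr_iso3 t)).

(* Both composites of f, g, h are compared with the strict composite of a
   strictly composable triple; [bic_assocK] below shows that the result does
   not depend on the triple. *)
Definition bic_assoc :
  @Iso (X1 X) (bic_comp (bic_comp f g) h) (bic_comp f (bic_comp g h)) :=
  let t := choose_triple f g h in
  comp_iso (bic_tripleR t)
    (comp_iso (idto_iso (hcoA (tr12 t) (tr23 t) : _ = _ :> X1 X))
       (inv_iso (bic_tripleL t))).

Lemma bic_assocK x y z (e1 : htgt x = hsrc y) (e2 : htgt y = hsrc z)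
    (phi : @hom (X1 X) x f) (chi : @hom (X1 X) y g) (psi : @hom (X1 X) z h) :
  compX (fwd bic_assoc)
    (@bic_into _ _ _ (bic_comp f g) h (hco e1) z e2
       (bic_into e1 phi chi) psi)
  = compX (@bic_into _ _ _ f (bic_comp g h) x (hco e2) e1 phi
       (bic_into e2 chi psi))
      (idto (hcoA e1 e2 : _ = _ :> X1 X)).
Proof.
pose t := choose_triple f g h.
have H : compX (fwd bic_assoc) (fwd (bic_tripleL t)) =
    compX (fwd (bic_tripleR t)) (idto (hcoA (tr12 t) (tr23 t) : _ = _ :> X1 X)).
  exact: comp_iso_invK.
pose d1 := compX (bwd (tr_iso1 t)) phi.
pose d2 := compX (bwd (tr_iso2 t)) chi.
pose d3 := compX (bwd (tr_iso3 t)) psi.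
have E1 : phi = compX (fwd (tr_iso1 t)) d1 by rewrite /d1 compmA fwdK comp1m.
have E2 : chi = compX (fwd (tr_iso2 t)) d2 by rewrite /d2 compmA fwdK comp1m.
have E3 : psi = compX (fwd (tr_iso3 t)) d3 by rewrite /d3 compmA fwdK comp1m.
rewrite E1 E2 E3.
rewrite -(bic_into_pre (tr12 t)) -(bic_into_pre (tr23 t)).
rewrite -(@bic_into_pre _ _ _ _ _ (hco (tr12 t)) _ (hco e1) _ (tr23 t)).
rewrite -(@bic_into_pre _ _ _ _ _ _ (hco (tr23 t)) _ (hco e2) (tr12 t)).
rewrite -[RHS]compmA -hc_assoc [LHS]compmA [RHS]compmA.
rewrite /bic_tripleL /bic_tripleR !bic_into_isoE in H.
by rewrite H.
Qed.

End Assoc.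

Lemma bic_assoc_nat (a b c d : pi0 (X0 X)) (f f' : barrow a b)
    (g g' : barrow b c) (h h' : barrow c d)
    (al : @hom (X1 X) f f') (be : @hom (X1 X) g g') (ga : @hom (X1 X) h h') :
  compX (fwd (bic_assoc f' g' h'))
    (@bic_comp2 a c d (bic_comp f g) (bic_comp f' g') h h'
       (bic_comp2 al be) ga)
  = compX (@bic_comp2 a b d f f' (bic_comp g h) (bic_comp g' h') al
       (bic_comp2 be ga)) (fwd (bic_assoc f g h)).
Proof.
have t := choose_triple f g h.
apply: (@iso_epi (X1 X) _ _ _ (bic_tripleL t)).
rewrite -[LHS]compmA -[RHS]compmA /bic_tripleL !bic_into_isoE.
rewrite bic_into_post bic_into_post !bic_assocK.
by rewrite [RHS]compmA !bic_into_post.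
Qed.

Lemma bic_pentagon (a b c d e : pi0 (X0 X)) (f : barrow a b)
    (g : barrow b c) (h : barrow c d) (k : barrow d e) :
  compX (fwd (bic_assoc f g (bic_comp h k)))
    (fwd (bic_assoc (bic_comp f g) h k))
  = compX (@bic_comp2 a b e f f (bic_comp (bic_comp g h) k)
             (bic_comp g (bic_comp h k)) (idX f) (fwd (bic_assoc g h k)))
      (compX (fwd (bic_assoc f (bic_comp g h) k))
         (@bic_comp2 a d e (bic_comp (bic_comp f g) h)
            (bic_comp f (bic_comp g h)) k k (fwd (bic_assoc f g h)) (idX k))).
Proof.
have [x [y [z [w [[e1 e2 e3] [[i1] [i2] [i3] [i4]]]]]]] := quad_exists f g h k.
pose E12 := bic_into_iso e1 i1 i2.
pose E123 := @bic_into_iso _ _ _ (bic_comp f g) h (hco e1) z e2 E12 i3.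
pose E := @bic_into_iso _ _ _ (bic_comp (bic_comp f g) h) k
  (@hco X (hco e1) z e2) w e3 E123 i4.
apply: (@iso_epi (X1 X) _ _ _ E).
rewrite -[LHS]compmA -[RHS]compmA.
rewrite -(compmA (fwd (bic_assoc f (bic_comp g h) k))).
rewrite /E bic_into_isoE /E123 bic_into_isoE /E12 bic_into_isoE.
rewrite bic_into_post comp1m !bic_assocK.
rewrite [LHS]compmA bic_assocK.
have [r ->] := @bic_into_idtoL _ _ _ (bic_comp f (bic_comp g h)) k
  (@hco X (hco e1) z e2) (@hco X x (hco e2) e1) w e3 e3
  (hcoA e1 e2) (@bic_into _ _ _ f (bic_comp g h) x (hco e2) e1 (fwd i1)
    (bic_into e2 (fwd i2) (fwd i3))) (fwd i4).
rewrite (compmA (fwd (bic_assoc f (bic_comp g h) k))) bic_assocK.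
rewrite (compmA (bic_comp2 _ _)) (compmA (bic_comp2 _ _)).
rewrite bic_into_post comp1m bic_assocK.
have [r' ->] := @bic_into_idtoR _ _ _ f (bic_comp g (bic_comp h k)) x
  (@hco X (hco e2) w e3) (@hco X y (hco e3) e2) e1 e1
  (hcoA e2 e3) (fwd i1) (@bic_into _ _ _ g (bic_comp h k) y (hco e3) e2
    (fwd i2) (bic_into e3 (fwd i3) (fwd i4))).
rewrite -!compmA !idto_compE.
by do 3!f_equal; apply: proof_irrelevance.
Qed.

Definition bic_unit_ver (A : X) (a : pi0 (X0 X)) (e : comp_of A = a) :
  @hom (X0 X) A (pinv mu0 a) :=
  fmap (pinv mu0) (e : @hom (discrete _) (comp_of A) a)
    \c fwd (pinv_unit mu0 A).

Definition bic_unit_ver_inv (A : X) (a : pi0 (X0 X)) (e : comp_of A = a) :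
  @hom (X0 X) (pinv mu0 a) A :=
  bwd (pinv_unit mu0 A)
    \c fmap (pinv mu0) (esym e : @hom (discrete _) a (comp_of A)).

Definition hid_sq (A B : X) (v : ver A B) :
  @hom (X1 X) (Arrow (hid A)) (Arrow (hid B)) :=
  @Square X (Arrow (hid A)) (Arrow (hid B)) v v (chid v).

Lemma hid_sqM (A B C : X) (w : ver B C) (v : ver A B) :
  compX (hid_sq w) (hid_sq v) = hid_sq (vcomp w v).
Proof. by rewrite /hid_sq chid_vcomp. Qed.

Lemma hid_sq1 (A : X) (v : ver A A) : hid_sq v = idX (Arrow (hid A)).
Proof. by rewrite (P v (vid A)) /hid_sq chid_vid. Qed.

Definition hid_iso (A B : X) (v : ver A B) (w : ver B A) :
  @Iso (X1 X) (Arrow (hid A)) (Arrow (hid B)) :=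
  @Build_Iso (X1 X) _ _ (hid_sq v) (hid_sq w)
    (etrans (hid_sqM w v) (hid_sq1 _)) (etrans (hid_sqM v w) (hid_sq1 _)).

Definition id_iso (C : Category) (x : C) : Iso x x :=
  @Build_Iso C x x (idm x) (idm x) (comp1m (idm x)) (comp1m (idm x)).

Section Unit.
Variables (a b : pi0 (X0 X)) (f : barrow a b).

Definition bic_lunit_into :
  @Iso (X1 X) (@hco X (Arrow (hid (hsrc f))) f erefl)
    (bic_comp (bic_id a) f) :=
  @bic_into_iso _ _ _ (bic_id a) f (Arrow (hid (hsrc f))) f erefl
    (hid_iso (bic_unit_ver (bsrc f)) (bic_unit_ver_inv (bsrc f)))
    (@id_iso (X1 X) f).

Definition bic_lunit : @Iso (X1 X) (bic_comp (bic_id a) f) f :=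
  comp_iso (idto_iso (@hco1l X f _ erefl : _ = _ :> X1 X))
    (inv_iso bic_lunit_into).

Definition bic_runit_into :
  @Iso (X1 X) (@hco X f (Arrow (hid (htgt f))) erefl)
    (bic_comp f (bic_id b)) :=
  @bic_into_iso _ _ _ f (bic_id b) f (Arrow (hid (htgt f))) erefl
    (@id_iso (X1 X) f)
    (hid_iso (bic_unit_ver (btgt f)) (bic_unit_ver_inv (btgt f))).

Definition bic_runit : @Iso (X1 X) (bic_comp f (bic_id b)) f :=
  comp_iso (idto_iso (@hco1r X f _ erefl : _ = _ :> X1 X))
    (inv_iso bic_runit_into).

Lemma bic_lunitK (A : X) (x : arrow X) (e : A = hsrc x)
    (u : ver A (pinv mu0 a)) (psi : @hom (X1 X) x f) :
  compX (fwd bic_lunit)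
    (@bic_into _ _ _ (bic_id a) f (Arrow (hid A)) x e (hid_sq u) psi)
  = compX psi (idto (hco1l e : _ = _ :> X1 X)).
Proof.
have H : compX (fwd bic_lunit) (fwd bic_lunit_into) =
    idto (@hco1l X f _ erefl : _ = _ :> X1 X) by apply: comp_iso_inv2K.
rewrite (P u (vcomp (bic_unit_ver (bsrc f))
  (vcomp (bic_unit_ver_inv (bsrc f)) u))) -hid_sqM -[psi in LHS]comp1m.
rewrite -(@bic_into_pre _ _ _ (bic_id a) f (Arrow (hid (hsrc f))) f
  (Arrow (hid A)) x erefl e).
rewrite /bic_lunit_into bic_into_isoE in H; rewrite [LHS]compmA.
by rewrite H; apply: hc_lunit.
Qed.

Lemma bic_runitK (A : X) (x : arrow X) (e : htgt x = A)
    (u : ver A (pinv mu0 b)) (psi : @hom (X1 X) x f) :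
  compX (fwd bic_runit)
    (@bic_into _ _ _ f (bic_id b) x (Arrow (hid A)) e psi (hid_sq u))
  = compX psi (idto (hco1r e : _ = _ :> X1 X)).
Proof.
have H : compX (fwd bic_runit) (fwd bic_runit_into) =
    idto (@hco1r X f _ erefl : _ = _ :> X1 X) by apply: comp_iso_inv2K.
rewrite (P u (vcomp (bic_unit_ver (btgt f))
  (vcomp (bic_unit_ver_inv (btgt f)) u))) -hid_sqM -[psi in LHS]comp1m.
rewrite -(@bic_into_pre _ _ _ f (bic_id b) f (Arrow (hid (htgt f)))
  x (Arrow (hid A)) erefl e).
rewrite /bic_runit_into bic_into_isoE in H; rewrite [LHS]compmA.
by rewrite H; apply: hc_runit.
Qed.

End Unit.

Lemma bic_lunit_nat (a b : pi0 (X0 X)) (f f' : barrow a b)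
    (al : @hom (X1 X) f f') :
  compX (fwd (bic_lunit f'))
    (@bic_comp2 a a b (bic_id a) (bic_id a) f f' (idX (bic_id a)) al)
  = compX al (fwd (bic_lunit f)).
Proof.
apply: (@iso_epi (X1 X) _ _ _ (bic_lunit_into f)).
rewrite -[LHS]compmA -[RHS]compmA /bic_lunit_into bic_into_isoE bic_into_post.
by rewrite comp1m !bic_lunitK compm1 comp1m.
Qed.

Lemma bic_runit_nat (a b : pi0 (X0 X)) (f f' : barrow a b)
    (al : @hom (X1 X) f f') :
  compX (fwd (bic_runit f'))
    (@bic_comp2 a b b f f' (bic_id b) (bic_id b) al (idX (bic_id b)))
  = compX al (fwd (bic_runit f)).
Proof.
apply: (@iso_epi (X1 X) _ _ _ (bic_runit_into f)).
rewrite -[LHS]compmA -[RHS]compmA /bic_runit_into bic_into_isoE bic_into_post.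
by rewrite comp1m !bic_runitK compm1 comp1m.
Qed.

Lemma bic_triangle (a b c : pi0 (X0 X)) (f : barrow a b) (g : barrow b c) :
  compX (@bic_comp2 a b c f f (bic_comp (bic_id b) g) g (idX f)
           (fwd (bic_lunit g)))
    (fwd (bic_assoc f (bic_id b) g))
  = @bic_comp2 a b c (bic_comp f (bic_id b)) f g g (fwd (bic_runit f)) (idX g).
Proof.
pose x := bic_fst f g; pose y := bic_snd f g.
pose e : htgt x = hsrc y := bic_match f g.
pose i := bic_fst_iso f g; pose j := bic_snd_iso f g.
pose B := htgt x.
have eB : comp_of B = b.
  exact: etrans (@component_hom (X0 X) _ _ (sright (fwd i))) (btgt f).
pose u := hid_iso (bic_unit_ver eB) (bic_unit_ver_inv eB).
pose E12 := @bic_into_iso _ _ _ f (bic_id b) x (Arrow (hid B)) erefl i u.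
pose E := @bic_into_iso _ _ _ (bic_comp f (bic_id b)) g
  (@hco X x (Arrow (hid B)) erefl) y e E12 j.
apply: (@iso_epi (X1 X) _ _ _ E).
rewrite -[LHS]compmA /E bic_into_isoE /E12 bic_into_isoE bic_assocK.
rewrite [LHS]compmA !bic_into_post !comp1m bic_runitK bic_lunitK.
have [r ->] := @bic_into_idtoL _ _ _ f g (@hco X x (Arrow (hid B)) erefl) x y
  e e (hco1r (erefl : htgt x = B)) (fwd i) (fwd j).
have [r' ->] := @bic_into_idtoR _ _ _ f g x (@hco X (Arrow (hid B)) y e) y
  erefl e (hco1l (e : B = hsrc y)) (fwd i) (fwd j).
rewrite -!compmA !idto_compE.
by f_equal; f_equal; apply: proof_irrelevance.
Qed.

Definition Bic : Bicategory :=
  @Build_Bicategory (pi0 (X0 X)) bic_hom bic_id bic_comp bic_comp2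
    bic_comp2_id bic_comp2_comp
    (fun a b c d f g h => bic_iso (bic_assoc f g h))
    (fun a b f => bic_iso (bic_lunit f))
    (fun a b f => bic_iso (bic_runit f))
    bic_assoc_nat bic_lunit_nat bic_runit_nat bic_pentagon bic_triangle.

End Bic.

(* Main.v *)
Require Import Defs.
From Corelib Require Import ssreflect ssrfun ssrbool.
From Stdlib Require Import Eqdep ProofIrrelevance.

Set Implicit Arguments.
Unset Strict Implicit.
Unset Printing Implicit Defensive.

(** Vertical arrows are unique and invertible, so [w] is a quasi unit iff [w] is
    isomorphic to [Id_A] in [X1]. Cells [chi' : w -> Id_A] correspond to cells
    [chi : w -> Id_B] by composing vertically with the invertible [id_v], and
    the interchange law gives
      [chi o psi = (id_v . chi') o (psi . 1) = (id_v o psi) . (chi' o 1)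
        = psi . chi'].
    Hence the companion equations [chi . psi = id_v] and [chi o psi = 1_w] say
    exactly that [chi' . psi = 1] and [psi . chi' = 1]. *)

(** Unpacking into nested dependent pairs lets [inj_pair2] strip the two fixed endpoints one after
    the other. *)
Lemma arrow_inj (X : DoubleCategory) (A B : X) (f g : hor A B) :
  Arrow f = Arrow g -> f = g.
Proof.
move=> e.
pose unpack (x : arrow X) :=
  existT (fun s => {t & hor s t}) (hsrc x) (existT _ (htgt x) (harr x)).
exact: inj_pair2 (inj_pair2 _ _ _ _ _ (f_equal unpack e)).
Qed.

Lemma cell_eq_square (X : DoubleCategory) (x y : arrow X) (s s' : square x y) :
  s = s' -> cell_eq (scell s) (scell s').
Proof. by move=> ->. Qed.

(** A converse of [square_idto] for fixed corners: [arrow_inj] turns [p] and [q] into equalities of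
    horizontal arrows, after which both transports are identities. *)
Lemma cell_eq_idto (X : DoubleCategory) (A B C D : X) (f f' : hor A B)
    (g g' : hor C D) (v v' : ver A C) (w w' : ver B D)
    (al : cell f v w g) (al' : cell f' v' w' g')
    (p : Arrow f = Arrow f' :> X1 X) (q : Arrow g = Arrow g' :> X1 X) :
  idto q \c (@Square X (Arrow f) (Arrow g) v w al : @hom (X1 X) _ _)
    = (@Square X (Arrow f') (Arrow g') v' w' al' : @hom (X1 X) _ _) \c idto p ->
  cell_eq al al'.
Proof.
have Ef := arrow_inj p; have Eg := arrow_inj q; subst f' g'.
rewrite !idto_id comp1m compm1 => e; exact: (cell_eq_square e).
Qed.

Section Companions.
Context {X : DoubleCategory} (P : forall (A B : X) (v w : ver A B), v = w).

Lemma hc_companion (A B : X) (w : hor A B) (v' : ver B A)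
    (psi : @hom (X1 X) (Arrow (hid A)) (Arrow w))
    (chi : @hom (X1 X) (Arrow w) (Arrow (hid B))) :
  idto (@hco1r X (Arrow w) B erefl : _ = _ :> X1 X)
    \c @hc X P (Arrow (hid A)) (Arrow w) (Arrow w) (Arrow (hid B)) erefl erefl
         psi chi
  = psi \c (hid_sq v' \c chi) \c idto (@hco1l X (Arrow w) A erefl : _ = _ :> X1 X).
Proof.
have chiE : chi = hid_sq (sright psi) \c (hid_sq v' \c chi).
  rewrite compmA hid_sqM (P (vcomp _ _) (vid _)) /hid_sq chid_vid.
  by rewrite (@comp1m (X1 X)).
rewrite [in LHS]chiE -[in LHS](compm1 psi).
rewrite (@hcM X P (Arrow (hid A)) (Arrow w) (Arrow (hid A)) (Arrow (hid A))
  (Arrow w) (Arrow (hid B)) erefl erefl erefl).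
rewrite compmA (@hc_runit X P (Arrow (hid A)) (Arrow w) A B erefl erefl).
set chi' := hid_sq v' \c chi.
move: {chiE} chi' => chi'.
rewrite -!compmA -(@hc_lunit X P (Arrow w) (Arrow (hid A)) A A erefl erefl
  (vid A) chi') chid_vid.
(* The right and left unit laws give two proofs that [Id_A o Id_A] is [Id_A]. *)
by rewrite (proof_irrelevance _ (hco1r _) (@hco1l X (Arrow (hid A)) A erefl)).
Qed.

Lemma companion_iso (inv : forall A B : X, ver A B -> ver B A) (A B : X)
    (w : hor A B) :
  has_vertical_companion w <->
  inhabited (@Iso (X1 X) (Arrow w) (Arrow (hid A))).
Proof.
split=> [[v [psi [chi [hE vE]]]] | [[chi' psi psiK chiK]]].
  pose psi' := @Square X (Arrow (hid A)) (Arrow w) _ _ psi.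
  pose chi' := @Square X (Arrow w) (Arrow (hid B)) _ _ chi.
  have H := @hc_companion A B w (inv _ _ v) psi' chi'.
  (* Domain and codomain of [chi o psi] equal [w] only up to the unit laws, hence the transports;
     the one left on both sides is cancelled as an isomorphism. *)
  rewrite hcE (square_idto (@hco1l X (Arrow w) A erefl) _
    (cell_eq_existT hE)) in H.
  constructor; exists (hid_sq (inv _ _ v) \c (chi' : @hom (X1 X) _ _)) psi'.
    exact: (iso_epi (f := idto_iso (@hco1l X (Arrow w) A erefl : _ = _ :> X1 X))
      (esym H)).
  have E : compm (chi' : @hom (X1 X) _ _) psi' = hid_sq v.
    exact: (@square_eq X (Arrow (hid A)) (Arrow (hid B))
      (@Square X (Arrow _) (Arrow _) _ _ (cvcomp chi psi)) (hid_sq v) vE).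
  rewrite -compmA E.
  by rewrite hid_sqM (P (vcomp _ _) (vid _)) /hid_sq chid_vid.
pose v := sright psi.
have := hc_companion (inv _ _ v) psi (hid_sq v \c chi').
have -> : hid_sq (inv _ _ v) \c (hid_sq v \c chi') = chi'.
  rewrite compmA hid_sqM (P (vcomp _ _) (vid _)) /hid_sq chid_vid.
  exact: (@comp1m (X1 X)).
have vE : hid_sq v \c chi' \c psi = hid_sq v.
  by rewrite -compmA chiK compm1.
rewrite psiK.
(* With the composite generalised to an arbitrary square [chi], uniqueness of vertical arrows forces
   the outer sides to be [1_A] and [1_B] and the left side of [chi] to be [v]. *)
move: (hid_sq v \c chi') vE; rewrite {}/v.
case: psi {chi' psiK chiK} => u v psi [u' v' chi].
have E := P u (vid A); subst u.
have E := P u' v; rewrite /= in E; subst u'.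
have E := P v' (vid B); subst v'.
move=> vE hE; exists v, psi, chi; split.
  exact: (cell_eq_idto (etrans (f_equal (compm _) (esym (hcE P psi chi))) hE)).
exact: (cell_eq_square vE).
Qed.

End Companions.

Theorem proposition3p5 (X : DoubleCategory) (hX : weakly_globular X)
    (mu0 : PseudoInverse (gamma0 X)) (mu2 : PseudoInverse (segal X 2))
    (A B : X) (w : hor A B) :
  (exists e : comp_of B = comp_of A,
     @quasi_unit (Bic hX mu0 mu2) (comp_of A)
       (@BArrow X (comp_of A) (comp_of A) (Arrow w) Logic.eq_refl e))
  <-> has_vertical_companion w.
Proof.
have P := gamma0_posetal (proj1 hX).
(* The arrow back from [D] to [C] passes through the object that [mu0] chooses in their common
   component. *)
have inv (C D : X) (v : ver C D) : ver D C.
  exact: vcomp (bic_unit_ver_inv mu0 erefl)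
    (bic_unit_ver mu0 (esym (@component_hom (X0 X) C D v))).
(* The unit of the bicategory is the identity on the chosen object of the component, so it is
   compared with [Id_A]. *)
pose i := hid_iso hX (bic_unit_ver mu0 (erefl (comp_of A)))
  (bic_unit_ver_inv mu0 erefl).
split=> [[e [[th th' thK th'K]]] | wC].
  apply/(companion_iso P inv); constructor.
  exact: comp_iso (inv_iso i) (@Build_Iso (X1 X) _ _ th th' thK th'K).
have [v _] := wC.
pose e := esym (@component_hom (X0 X) A B v).
have [j] := proj1 (companion_iso P inv w) wC.
exists e; constructor.
exact: (@bic_iso X _ _ (BArrow (erefl : comp_of (hsrc (Arrow w)) = _) e)
  (bic_id mu0 _) (comp_iso i j)).
Qed.
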